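(* If $G$ is a connected graph on at most $9$ vertices, then $c(G)\leq 2$.
   Context: Cops and Robbers is played on a finite, connected, undirected graph $G$. A set of cops first each choose a starting vertex, then the robber chooses a starting vertex; thereafter the players alternate rounds, cops first. In the cops' round each cop either moves to an adjacent vertex or stays put (several cops may occupy the same vertex); in the robber's round the robber moves to an adjacent vertex or stays put. The cops win if after finitely many rounds some cop occupies the robber's vertex; the robber wins if he can avoid this forever. Both players have full information. The cop number $c(G)$ is the minimum number of cops for which the cops have a winning strategy. *)

(* Defs.v *)
From HB Require Import structures.
From mathcomp Require Import all_boot.
From mathcomp Require Import boolp.

Set Implicit Arguments.
Unset Strict Implicit.
Unset Printing Implicit Defensive.

Definition graph_connected (T : finType) (e : rel T) : Prop :=
  0 < #|T| /\ forall x y : T, connect e x y.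

Definition step (T : finType) (e : rel T) (x y : T) : Prop := x = y \/ e x y.

(* [r n] is the robber's vertex after his [n]-th move, [r 0] being his initial
   choice. *)
Definition robber_walk (T : finType) (e : rel T) (r : nat -> T) : Prop :=
  forall n, step e (r n) (r n.+1).

(* A (deterministic, full-information) strategy for [k] cops maps the list of
   vertices occupied so far by the robber, in chronological order, to the next
   positions of the cops; its value at [[::]] is their initial placement.  Since
   the cops' own past positions are the values of the strategy at the prefixes
   of that list, it determines the whole history of the play. *)
Definition cop_strategy (T : finType) (k : nat) := seq T -> {ffun 'I_k -> T}.

(* Against [r], the order of play is
     s [::],  r 0,  s [:: r 0],  r 1,  s [:: r 0; r 1],  r 2, ...
   so that [s (mkseq r n)] are the positions of the cops when the robber arrives
   at [r n], and [s (mkseq r n.+1)] those they take in reply. *)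
Definition legal_strategy (T : finType) (e : rel T) (k : nat)
    (s : cop_strategy T k) : Prop :=
  forall r, robber_walk e r ->
  forall n (i : 'I_k), step e (s (mkseq r n) i) (s (mkseq r n.+1) i).

(* The capture may occur on a robber's turn (including his initial choice) or on
   a cops' turn. *)
Definition captures (T : finType) (k : nat) (s : cop_strategy T k)
    (r : nat -> T) : Prop :=
  exists n, exists i : 'I_k, s (mkseq r n) i = r n \/ s (mkseq r n.+1) i = r n.

(* As [s] is deterministic, the robber's counter-strategies amount to all the
   walks [r]. *)
Definition winning_strategy (T : finType) (e : rel T) (k : nat)
    (s : cop_strategy T k) : Prop :=
  legal_strategy e s /\ forall r, robber_walk e r -> captures s r.

Definition cops_win (T : finType) (e : rel T) (k : nat) : Prop :=
  exists s : cop_strategy T k, winning_strategy e s.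

Lemma cops_win_card (T : finType) (e : rel T) : cops_win e #|T|.
Proof.
exists (fun=> [ffun i => enum_val i]); split=> [r _ n i|r _]; first by left.
by exists 0, (enum_rank (r 0)); left; rewrite ffunE enum_rankK.
Qed.

Lemma exists_cops_win (T : finType) (e : rel T) :
  exists k, `[< cops_win e k >].
Proof. by exists #|T|; apply/asboolP/cops_win_card. Qed.

Definition cop_number (T : finType) (e : rel T) : nat :=
  ex_minn (exists_cops_win e).

(* Main.v *)
Require Import Defs.
From HB Require Import structures.
From mathcomp Require Import all_boot.
From mathcomp Require Import boolp.
From mathcomp Require Import zify.

(** Let [v] have maximum degree [d], and keep one cop at [v] while the robber
    moves in a component [K] of the graph of non-neighbours of [v]; since the
    graph has at most nine vertices, [#|K| <= 8 - d].  If [K] has maximum degree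
    at most two and is not a cycle, the second cop sweeps it.  If the second cop
    covers all the [K]-neighbours of the robber's vertex [q], the robber is
    stuck, and the first cop wins by moving next to [q] unless two neighbours of
    [q] escape the second cop.  Counting vertices and degrees, the survivors are
    an induced 4-cycle with [d = 4] and an induced 5-cycle with [d = 3], both
    filling the non-neighbourhood of [v].  There the first cop leaves [v] to
    flush the robber out of [K] and comes back; that this fails everywhere forces a
    neighbour of [v] to have more than [d] neighbours. *)

Set Implicit Arguments.
Unset Strict Implicit.
Unset Printing Implicit Defensive.

(** * Bounded wins and safe positions *)

Section TwoCops.
Variables (T : finType) (e : rel T).
Implicit Types (a b r u v w x y z : T) (X K : {set T}) (s : seq T).

(** The cops are to move, and [n] bounds their rounds. A robber who walks onto a cop is caught one
    round later, by that cop staying put. *)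
Fixpoint wins_in n a b r : Prop :=
  if n is m.+1 then
    exists a' b', [/\ step e a a', step e b b' &
      [\/ a' = r, b' = r | forall r', step e r r' -> wins_in m a' b' r']]
  else False.

Lemma wins_in_leq m n a b r : m <= n -> wins_in m a b r -> wins_in n a b r.
Proof.
elim: m n a b r => [|m IH] [|n] a b r //= lemn [a' [b' [sa sb H]]].
exists a', b'; split=> //; case: H => H; [exact: Or31|exact: Or32|apply: Or33].
by move=> r' /H; apply: IH.
Qed.

Definition reply_decreases a b r (p : T * T) :=
  [/\ step e a p.1, step e b p.2 & forall n, wins_in n.+1 a b r ->
    [\/ p.1 = r, p.2 = r | forall r', step e r r' -> wins_in n p.1 p.2 r']].

(** The reply that wins in the fewest rounds serves for every [n] by [wins_in_leq]; if no bound
    works, the cops stay put. *)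
Lemma exists_reply a b r : exists p, reply_decreases a b r p.
Proof.
case: (pselect (exists n, wins_in n a b r)) => [exn|noW]; last first.
  exists (a, b); split; [by left|by left|] => n W.
  by case: noW; exists n.+1.
have exb : exists n, `[< wins_in n a b r >].
  by case: exn => n W; exists n; apply/asboolP.
case: (ex_minnP exb) => [[|m] /asboolP //= [a' [b' [sa sb H]]] min_m].
exists (a', b'); split=> // n W; case: H => H; [exact: Or31|exact: Or32|].
apply: Or33 => r' /H; apply: wins_in_leq.
by rewrite -ltnS; apply: min_m; apply/asboolP.
Qed.

(** The strategy folds the chosen replies over the robber's history; the bound drops by one each
    round. *)
Lemma wins_in_cops_win a0 b0 :
  (forall r, exists n, wins_in n a0 b0 r) -> cops_win e 2.
Proof.
move=> W0.
have [mv mvP] := choice (fun t => exists_reply t.1.1 t.1.2 t.2).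
pose pos h := foldl (fun p r => mv (p, r)) (a0, b0) h.
pose s : cop_strategy T 2 :=
  fun h => [ffun i => if i == ord0 then (pos h).1 else (pos h).2].
have posS (r : nat -> T) n : pos (mkseq r n.+1) = mv (pos (mkseq r n), r n).
  by rewrite mkseqS /pos foldl_rcons.
exists s; split=> [r _ n i|r rW].
  rewrite !ffunE posS; have [/= s1 s2 _] := mvP (pos (mkseq r n), r n).
  by case: ifP.
suff capt m n : wins_in m (pos (mkseq r n)).1 (pos (mkseq r n)).2 (r n) ->
    captures s r.
  by have [m] := W0 (r 0); apply: (capt m 0).
elim: m n => [//|m IH] n W.
have [_ _ /(_ _ W)] := mvP (pos (mkseq r n), r n); rewrite -posS /=.
case=> [p1|p2|W'].
- by exists n, ord0; right; rewrite ffunE.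
- by exists n, ord_max; right; rewrite ffunE.
- by apply: (IH n.+1); apply: W'; apply: rW.
Qed.

Definition safe a b r := forall n, ~ wins_in n a b r.

(** If all replies lost, their bounds would have a maximum, [T] being finite, and one more round
    would win from the old position. *)
Lemma safe_step a b r a' b' : safe a b r -> step e a a' -> step e b b' ->
  exists2 r', step e r r' & safe a' b' r'.
Proof.
move=> S sa sb; apply: contrapT => noS.
have W r' : exists n, step e r r' -> wins_in n a' b' r'.
  case: (pselect (step e r r')) => [sr|]; last by exists 0.
  apply: contrapT => noW; apply: noS; exists r' => // n Wn.
  by apply: noW; exists n.
have [f fW] := choice W.
apply: (S (\max_x f x).+1); exists a', b'; split=> //; apply: Or33 => r' sr.
by apply: wins_in_leq (fW _ sr); apply: leq_bigmax.
Qed.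

Lemma safe_farl a b r : safe a b r -> ~ step e a r.
Proof.
move=> S sa; apply: (S 1); exists r, b.
by split=> //; [left|exact: Or31].
Qed.

Lemma safe_farr a b r : safe a b r -> ~ step e b r.
Proof.
move=> S sb; apply: (S 1); exists a, r.
by split=> //; [left|exact: Or32].
Qed.

(** * Neighbourhoods and connectedness *)

Definition nbhd x := [set y | e x y].

Lemma nbhd_ltn_size x s d :
  #|nbhd x| <= d -> uniq s -> d < size s -> ~ all (e x) s.
Proof.
move=> degx us; rewrite ltnNge => /negP ltd /allP xs; apply: ltd.
rewrite -(card_uniqP us); apply: leq_trans degx; apply/subset_leq_card.
by apply/subsetP => y /xs; rewrite inE.
Qed.

Hypotheses (e_sym : symmetric e) (e_irr : irreflexive e).
(** [X] misses the closed neighbourhood of [v], which has one vertex more than [nbhd v]. *)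
Lemma card_far_nbhd v X : (forall x, x \in X -> ~ step e v x) ->
  #|X| + #|nbhd v| < #|T|.
Proof.
move=> far; have dis : [disjoint X & v |: nbhd v].
  apply/pred0P => x /=; apply/negbTE/negP; rewrite !inE => /andP [/far nvx].
  by case/orP => [/eqP xv|vx]; apply: nvx; [left|right].
have := max_card (X :|: (v |: nbhd v)).
rewrite cardsU disjoint_setI0 // cards0 subn0 cardsU1 inE e_irr /=.
by rewrite addnA addn1 addSn.
Qed.

Lemma eq_mem_card X s :
  uniq s -> {subset s <= X} -> #|X| <= size s -> X =i s.
Proof.
move=> us sX leX; have sE : {subset s <= enum X}.
  by move=> x /sX; rewrite mem_enum.
have [|_ eqs] := uniq_min_size us sE; first by rewrite -cardE.
by move=> x; rewrite eqs mem_enum.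
Qed.

Hypothesis e_conn : forall x y, connect e x y.

Lemma nbr_closed_setT X x :
  x \in X -> (forall y z, y \in X -> e y z -> z \in X) -> forall y, y \in X.
Proof.
move=> xX cl y; have /connectP [p] := e_conn x y.
elim: p x xX => [|z p IH] x xX /= => [_ -> //|/andP [xz zp]].
by apply: IH zp; apply: cl xX xz.
Qed.

(** * A robber confined by one cop *)

Section Confined.
(* The first cop waits at [v], which confines the robber to [K]. *)
Variables (v : T) (K : {set T}).
Hypothesis K_far : forall x, x \in K -> ~ step e v x.
Hypothesis K_closed : forall x y, x \in K -> e x y -> y \notin K -> e v y.
Hypothesis K_connected : forall X x, X \subset K -> x \in X ->
  (forall y z, y \in X -> z \in K -> e y z -> z \in X) -> K \subset X.
Hypothesis K_robber : forall u, exists2 r, r \in K & safe v u r.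

Definition Knbhd x := nbhd x :&: K.

(** Leaving [K] would put the robber next to the first cop. *)
Lemma safe_stepK u r u' : r \in K -> safe v u r -> step e u u' ->
  exists r', [/\ r' \in K, step e r r' & safe v u' r'].
Proof.
move=> rK S su; have [r' sr S'] := safe_step S (or_introl erefl) su.
exists r'; split=> //; case: sr => [<- //|rr'].
apply: contrapT => /negP /(K_closed rK rr') vr'.
by apply: (safe_farl S'); right.
Qed.

(* The second cop enters the territory [X] through its only entrance [u]: the
   robber cannot get around him, and [X] shrinks. *)
Lemma territory_captured X u r : (forall x, x \in K -> #|Knbhd x| <= 2) ->
  X \subset K -> u \in K :\: X ->
  (forall y z, y \in X -> z \in K -> e y z -> z \in u |: X) ->
  #|nbhd u :&: X| <= 1 -> r \in X -> ~ safe v u r.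
Proof.
move=> deg2; have [m] := ubnP #|X|; elim: m X u r => // m IH X u r.
move=> ltXm XK; rewrite inE => /andP [uX uK] Xcl entr rX S.
(* Without an edge from [u] into [X], the territory would be closed in [K] and hence contain [u]. *)
have [noE|[u']] := set_0Vmem (nbhd u :&: X).
  have /subsetP/(_ u uK) : K \subset X.
    apply: (K_connected XK rX) => y z yX zK yz.
    move: (Xcl _ _ yX zK yz); rewrite inE in_set1 => /orP [/eqP zu|//].
    have : y \in nbhd u :&: X by rewrite !inE -zu e_sym yz.
    by rewrite noE in_set0.
  by rewrite (negbTE uX).
rewrite !inE => /andP [uu' u'X].
have only y : y \in X -> e u y -> y = u'.
  by move=> yX uy; apply: (card_le1_eqP entr); rewrite !inE ?uy ?uu'.
have [r' [r'K sr S']] := safe_stepK (subsetP XK _ rX) S (or_intror uu').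
have ru' : r != u'.
  by apply/eqP => ru'; apply: (safe_farr S); right; rewrite ru'.
have r'X : r' \in X :\ u'.
  rewrite !inE; apply/andP; split.
    by apply/eqP => r'u'; apply: (safe_farr S'); left.
  case: sr => [<- //|rr']; move: (Xcl _ _ rX r'K rr').
  rewrite !inE => /orP [/eqP r'u|//]; case: (safe_farr S'); right.
  by rewrite r'u e_sym.
apply: IH r'X S'.
- by move: ltXm; rewrite (cardsD1 u' X) u'X.
- exact: subset_trans (subD1set _ _) XK.
- by rewrite !inE eqxx /= (subsetP XK).
- move=> y z; rewrite !inE => /andP [yu' yX] zK yz.
  case: eqP => //= /eqP zu'; move: (Xcl _ _ yX zK yz).
  rewrite !inE => /orP [/eqP zu|//].
  by case/eqP: yu'; apply: only => //; rewrite e_sym -zu.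
(* One of the at most two [K]-neighbours of [u'] is [u], so at most one leads on into the smaller
   territory. *)
- have := deg2 u' (subsetP XK _ u'X); rewrite (cardsD1 u) !inE e_sym uu' uK /=.
  rewrite add1n ltnS; apply: leq_trans; apply/subset_leq_card/subsetP => y.
  rewrite !inE => /and3P [u'y _ yX]; rewrite u'y (subsetP XK) // !andbT.
  by apply: contraNneq uX => <-.
Qed.

(** The sweep starts at [u], with the rest of [K] as territory. *)
Lemma path_like_captured u :
  (forall x, x \in K -> #|Knbhd x| <= 2) -> u \in K -> ~ #|Knbhd u| <= 1.
Proof.
move=> deg2 uK deg1; have [r rK S] := K_robber u.
apply: (@territory_captured (K :\ u) u r) => //.
- exact: subD1set.
- by rewrite !inE uK eqxx.
- by move=> y z _ zK _; rewrite !inE zK andbT orbN.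
- apply: leq_trans deg1; apply/subset_leq_card/setIS; exact: subD1set.
- rewrite !inE rK andbT; apply/eqP => ru; apply: (safe_farr S); left.
  by rewrite ru.
Qed.

(* As long as the second cop covers the [K]-neighbours of [q], the robber cannot
   leave [q], so the first cop may walk to the only other neighbour of [q]. *)
Lemma pinned_nbhd u q : q \in K -> safe v u q -> Knbhd q \subset nbhd u ->
  1 < #|nbhd q :\: nbhd u|.
Proof.
move=> qK S cov; rewrite ltnNge; apply/negP => le1.
have [noN|[a]] := set_0Vmem (nbhd q :\: nbhd u).
  (* While the second cop stays at [u], the robber stays at [q] wherever the first cop walks, even
     onto [q]. *)
  have frozen w : w \in [set w | `[< safe w u q >]].
    apply: (@nbr_closed_setT _ v); first by rewrite inE; apply/asboolP.
    move=> y z; rewrite !inE => /asboolP Sy yz; apply/asboolP.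
    have [r' [<- //|qr'] S'] := safe_step Sy (or_intror yz) (or_introl erefl).
    have : r' \in nbhd q :\: nbhd u.
      rewrite !inE qr' andbT; apply/negP => ur'; apply: (safe_farr S').
      by right.
    by rewrite noN in_set0.
  have := frozen q; rewrite inE => /asboolP /safe_farl; apply.
  by left.
rewrite !inE => /andP [ua qa].
have aK : a \notin K.
  apply: contra ua => aK.
  by have := subsetP cov a; rewrite !inE qa aK => /(_ isT).
(* With the first cop on [a], the robber cannot stay at [q], and the second cop covers every other
   neighbour of [q]. *)
have [r' sr S'] := safe_step S (or_intror (K_closed qK qa aK)) (or_introl erefl).
case: sr => [r'q|qr'].
  by apply: (safe_farl S'); right; rewrite -r'q e_sym.
case ur' : (e u r'); first by apply: (safe_farr S'); right.
suff r'a : r' = a by apply: (safe_farl S'); left.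
by apply: (card_le1_eqP le1); rewrite !inE ?ur' ?qr' ?ua ?qa.
Qed.

(** If [x] were the only [K]-neighbour of [r], the second cop could step onto it and catch the
    robber next. With none, [K] would be [[set r]], yet it contains [u]. *)
Lemma Knbhd_gt1 u r : u \in K -> r \in K -> safe v u r ->
  Knbhd r \subset nbhd u -> 1 < #|Knbhd r|.
Proof.
move=> uK rK S cov; rewrite ltnNge; apply/negP => le1.
have [noN|[x xN]] := set_0Vmem (Knbhd r).
  have /subsetP/(_ u uK) : K \subset [set r].
    apply: (K_connected _ (set11 r)); first by rewrite sub1set.
    move=> y z /set1P -> zK rz; have : z \in Knbhd r by rewrite !inE rz.
    by rewrite noN in_set0.
  by move/set1P => ur; apply: (safe_farr S); left.
have ux : e u x by have := subsetP cov _ xN; rewrite inE.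
have [r' [r'K sr S']] := safe_stepK rK S (or_intror ux).
apply: (safe_farr S'); case: sr => [<-|rr'].
  by right; move: xN; rewrite !inE e_sym => /andP [].
by left; apply: (card_le1_eqP le1) => //; rewrite !inE rr'.
Qed.

Lemma Knbhd_count s x : uniq s -> K =i s -> #|Knbhd x| = count (e x) s.
Proof.
move=> us Ks; rewrite -size_filter.
have /card_uniqP <- : uniq (filter (e x) s) by apply: filter_uniq.
by apply: eq_card => y; rewrite !inE mem_filter Ks.
Qed.

(** * Induced 4-cycles filling the non-neighbourhood *)

Section Full.
Hypothesis K_full : forall x, x \notin K -> step e v x.

Lemma K_out x y : x \in K -> y \notin K -> e x y -> e v y.
Proof. by move=> xK yK /K_closed; apply. Qed.

Lemma safe_K u r : safe v u r -> r \in K.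
Proof. by move=> S; apply: contrapT => /negP/K_full; apply: safe_farl S. Qed.

Definition cycle4 p0 p1 p2 p3 :=
  [/\ uniq [:: p0; p1; p2; p3], K =i [:: p0; p1; p2; p3],
      [&& e p0 p1, e p1 p2, e p2 p3 & e p3 p0] & ~~ e p0 p2 && ~~ e p1 p3].

Lemma cycle4_rot p0 p1 p2 p3 : cycle4 p0 p1 p2 p3 -> cycle4 p1 p2 p3 p0.
Proof.
case=> u KE /and4P [e01 e12 e23 e30] /andP [n02 n13]; split.
- by rewrite -(rot_uniq 1) in u.
- by move=> x; rewrite KE -(mem_rot 1).
- by apply/and4P.
- by rewrite n13 e_sym.
Qed.

Lemma cycle4_opp p0 p1 p2 p3 r :
  cycle4 p0 p1 p2 p3 -> r \in K -> safe v p0 r -> r = p2.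
Proof.
case=> _ KE /and4P [e01 _ _ e30] _; rewrite KE !inE => rp S.
have := safe_farr S; case/or4P: rp => /eqP -> // []; [by left|by right|].
by right; rewrite e_sym.
Qed.

(** A second cop on [p3] covers both cycle neighbours of [p1], so [pinned_nbhd] applies to the
    robber at [p1]. *)
Lemma cycle4_out p0 p1 p2 p3 : cycle4 p0 p1 p2 p3 ->
  1 < #|nbhd p1 :\: nbhd p3| /\
  (forall b, b \in nbhd p1 :\: nbhd p3 -> b \notin K).
Proof.
move=> C; have [u KE /and4P [e01 e12 e23 e30] /andP [n02 n13]] := C.
have cov b : e p1 b -> b \in K -> e p3 b.
  move=> p1b; rewrite KE !inE => /or4P [] /eqP bE; subst b => //.
  - by rewrite e_irr in p1b.
  - by rewrite e_sym.
  - by rewrite p1b in n13.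
split.
  have [r rK S] := K_robber p3.
  have C3 : cycle4 p3 p0 p1 p2 by do 3!apply: cycle4_rot.
  have rE := cycle4_opp C3 rK S.
  subst r; apply: pinned_nbhd => //; apply/subsetP => b.
  by rewrite !inE => /andP []; apply: cov.
move=> b; rewrite !inE => /andP [n3b p1b].
by apply: contra n3b => /(cov _ p1b).
Qed.

(** With the robber at [p1] and the second cop on [p3], the first cop moves to another outside
    neighbour [a] of [p1]; the degree bound leaves only [b] to the robber. When the first cop
    returns to [v], the second goes to [p2] or [p0], and the robber must step from [b] to the
    opposite vertex. *)
Lemma cycle4_step p0 p1 p2 p3 b : (forall x, #|nbhd x| <= 4) ->
  cycle4 p0 p1 p2 p3 -> b \notin K -> e p1 b -> e b p0 && e b p2.
Proof.
move=> deg4 C bK p1b; have [u KE /and4P [e01 e12 e23 e30] _] := C.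
have inK x : x \in [:: p0; p1; p2; p3] -> x \in K by rewrite KE.
have C1 := cycle4_rot C; have C2 := cycle4_rot C1; have C3 := cycle4_rot C2.
have [gt1 out] := cycle4_out C.
have [a aN ab] : exists2 a, a \in nbhd p1 :\: nbhd p3 & a != b.
  have [a1 [a2 [a1N a2N a12]]] := card_gt1P gt1.
  have [a1b|] := eqVneq a1 b; last by exists a1.
  by exists a2 => //; rewrite -a1b eq_sym.
have aK := out _ aN; move: aN; rewrite !inE => /andP [n3a p1a].
have va : e v a by apply: (K_out _ aK p1a); rewrite KE !inE eqxx orbT.
have [r rK S] := K_robber p3.
have rE := cycle4_opp C3 rK S; subst r.
have [r' sr S'] := safe_step S (or_intror va) (or_introl erefl).
have r'b : r' = b.
  apply: contrapT => /eqP r'b.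
  have r'a : r' != a by apply/eqP => r'a; apply: (safe_farl S'); left.
  case: sr => [r'E|p1r'].
    by apply: (safe_farl S'); right; rewrite e_sym -r'E.
  apply: (@nbhd_ltn_size p1 [:: p0; p2; a; b; r'] 4 (deg4 p1)) => //.
  - have neK x y : x \in K -> y \notin K -> x != y.
      by move=> xK; apply: contraNneq => <-.
    have ne3 x : e p3 x -> x != r'.
      by move=> p3x; apply: contra_not_neq (safe_farr S') => <-; right.
    have [p0K p2K] : p0 \in K /\ p2 \in K by rewrite !KE !inE !eqxx !orbT.
    rewrite /= !inE !negb_or (neK _ _ p0K aK) (neK _ _ p0K bK).
    rewrite (neK _ _ p2K aK) (neK _ _ p2K bK) (ne3 p0) // (ne3 p2).
      rewrite ab (eq_sym a) r'a (eq_sym b) r'b !andbT.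
      by move: u; rewrite /= !inE; case: (p0 == p2); rewrite ?orbT.
    by rewrite e_sym.
  - by rewrite /= (e_sym p1 p0) e01 e12 p1a p1b p1r'.
subst r'.
have bne x : x \in [:: p0; p1; p2; p3] -> b <> x.
  by move=> /inK xK bx; rewrite bx xK in bK.
have av : step e a v by right; rewrite e_sym.
apply/andP; split.
  have [|r'' sr'' S''] := safe_step S' av (_ : step e p3 p2).
    by right; rewrite e_sym.
  have rE := cycle4_opp C2 (safe_K S'') S''; subst r''.
  by case: sr'' => // /bne; rewrite !inE eqxx ?orbT => /(_ isT).
have [|r'' sr'' S''] := safe_step S' av (_ : step e p3 p0); first by right.
have rE := cycle4_opp C (safe_K S'') S''; subst r''.
by case: sr'' => // /bne; rewrite !inE eqxx ?orbT => /(_ isT).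
Qed.

(** [cycle4_step], used at [p1] and then at [p0], makes [b] adjacent to the whole cycle; [v] is a
    fifth neighbour. *)
Lemma no_cycle4 p0 p1 p2 p3 :
  (forall x, #|nbhd x| <= 4) -> ~ cycle4 p0 p1 p2 p3.
Proof.
move=> deg4 C; have [u KE _ _] := C.
have [/ltnW/card_gt0P [b bN] out] := cycle4_out C.
have bK := out _ bN; move: bN; rewrite !inE => /andP [_ p1b].
have /andP [b0 b2] := cycle4_step deg4 C bK p1b.
have C3 : cycle4 p3 p0 p1 p2 by do 3!apply: cycle4_rot.
have /andP [b3 _] : e b p3 && e b p1.
  by apply: cycle4_step C3 bK _ => //; rewrite e_sym.
have p1K : p1 \in K by rewrite KE !inE eqxx orbT.
apply: (@nbhd_ltn_size b [:: v; p0; p1; p2; p3] 4 (deg4 b)) => //.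
- rewrite cons_uniq u andbT -KE; apply/negP => /K_far; apply.
  by left.
- by rewrite /= b0 b2 b3 !(e_sym b) p1b (K_out p1K bK p1b).
Qed.

(** * Induced 5-cycles filling the non-neighbourhood *)

Definition cycle5 p0 p1 p2 p3 p4 :=
  [/\ uniq [:: p0; p1; p2; p3; p4], K =i [:: p0; p1; p2; p3; p4],
      [&& e p0 p1, e p1 p2, e p2 p3, e p3 p4 & e p4 p0] &
      [&& ~~ e p0 p2, ~~ e p1 p3, ~~ e p2 p4, ~~ e p3 p0 & ~~ e p4 p1]].

(* A chasing cop two steps ahead of the robber on the cycle can keep turning him
   in the same direction, see [chase5_rotr]. *)
Definition chase5 p0 p1 p2 p3 p4 := cycle5 p0 p1 p2 p3 p4 /\ safe v p2 p0.

Lemma cycle5_rotr p0 p1 p2 p3 p4 :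
  cycle5 p0 p1 p2 p3 p4 -> cycle5 p4 p0 p1 p2 p3.
Proof.
case=> u KE /and5P [e01 e12 e23 e34 e40] /and5P [n02 n13 n24 n30 n41]; split.
- by rewrite -(rotr_uniq 1) in u.
- by move=> x; rewrite KE -(mem_rotr 1).
- by apply/and5P.
- by apply/and5P.
Qed.

Lemma cycle5_rev p0 p1 p2 p3 p4 :
  cycle5 p0 p1 p2 p3 p4 -> cycle5 p4 p3 p2 p1 p0.
Proof.
case=> u KE /and5P [e01 e12 e23 e34 e40] /and5P [n02 n13 n24 n30 n41]; split.
- by rewrite -rev_uniq in u.
- by move=> x; rewrite KE -mem_rev.
- by apply/and5P; split; rewrite e_sym.
- by apply/and5P; split; rewrite e_sym.
Qed.

Lemma cycle5_opp p0 p1 p2 p3 p4 r : cycle5 p0 p1 p2 p3 p4 ->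
  safe v p2 r -> r = p0 \/ r = p4.
Proof.
case=> _ KE /and5P [_ e12 e23 _ _] _ S; have := safe_K S.
rewrite KE !inE => rp; have := safe_farr S.
case/or4P: rp => [/eqP->|/eqP->|/eqP->|/orP [] /eqP->]; first by left.
- by case; right; rewrite e_sym.
- by case; left.
- by case; right.
- by right.
Qed.

Lemma cycle5_nbr p0 p1 p2 p3 p4 a x : (forall x, #|nbhd x| <= 3) ->
  cycle5 p0 p1 p2 p3 p4 -> a \notin K -> e p0 a -> e p0 x ->
  [\/ x = p1, x = p4 | x = a].
Proof.
move=> deg3 [u KE /and5P [e01 _ _ _ e40] _] aK p0a p0x.
have aNp y : y \in [:: p0; p1; p2; p3; p4] -> y != a.
  by rewrite -KE; apply: contraTneq => ->.
have [->|x1] := eqVneq x p1; first exact: Or31.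
have [->|x4] := eqVneq x p4; first exact: Or32.
have [->|xa] := eqVneq x a; first exact: Or33.
exfalso; apply: (@nbhd_ltn_size p0 [:: x; p1; p4; a] 3 (deg3 p0)) => //.
  rewrite /= !inE !negb_or x1 x4 xa !aNp ?inE ?eqxx ?orbT // !andbT.
  by move: u; rewrite /= !inE; case: (p1 == p4); rewrite ?orbT ?andbF.
by rewrite /= p0x e01 (e_sym p0 p4) e40 p0a.
Qed.

(** The second cop steps to [p1], leaving only [p3] and [p4] uncovered; of these the robber can
    reach [p4] alone. *)
Lemma chase5_rotr p0 p1 p2 p3 p4 :
  chase5 p0 p1 p2 p3 p4 -> chase5 p4 p0 p1 p2 p3.
Proof.
move=> [C S]; split; first exact: cycle5_rotr.
have [u KE /and5P [e01 e12 e23 e34 e40] /and5P [n02 n13 n24 n30 n41]] := C.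
have [r' [r'K sr S']] := safe_stepK (safe_K S) S
  (or_intror (etrans (e_sym p2 p1) e12)).
have [r'E|r'E] := cycle5_opp (cycle5_rotr C) S'; subst r' => //.
case: sr => [p03|p03]; last by rewrite e_sym p03 in n30.
by move: u; rewrite p03 /= !inE eqxx !orbT.
Qed.

(** The first cop moves to [a], driving the robber to [p4]; the second steps to [p3], flushing him
    out to some [b]. Once the first is back on [v], the robber must enter [p0] or [p1], but [a] is
    the only outside neighbour of [p0]. *)
Lemma chase5_step p0 p1 p2 p3 p4 a : (forall x, #|nbhd x| <= 3) ->
  chase5 p0 p1 p2 p3 p4 -> a \notin K -> e p0 a ->
  exists b, [/\ b \notin K, e p4 b & e p1 b].
Proof.
move=> deg3 [C S] aK p0a.
have [u KE /and5P [e01 e12 e23 e34 e40] /and5P [n02 n13 n24 n30 n41]] := C.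
have p0K := safe_K S; have va := K_out p0K aK p0a.
have [r1 sr1 S1] := safe_step S (or_intror va) (or_introl erefl).
have r1E : r1 = p4.
  case: sr1 => [r1E|/(cycle5_nbr deg3 C aK p0a) [r1E|//|r1E]].
  - by case: (safe_farl S1); right; rewrite -r1E e_sym.
  - by case: (safe_farr S1); right; rewrite r1E e_sym.
  - by case: (safe_farl S1); left.
subst r1.
have [b sb S2] := safe_step S1 (or_introl erefl) (or_intror e23).
have p4b : e p4 b.
  by case: sb => // p4b; case: (safe_farr S2); right; rewrite -p4b.
have bp0 : b <> p0 by move=> bE; apply: (safe_farl S2); right; rewrite bE e_sym.
have p4K : p4 \in K by rewrite KE !inE eqxx !orbT.
have bK : b \notin K.
  apply/negP; rewrite KE !inE => bp; have := safe_farr S2.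
  case/or4P: bp => [/eqP //|/eqP bE|/eqP bE|/orP [] /eqP bE].
  - by rewrite -bE p4b in n41.
  - by rewrite -bE e_sym p4b in n24.
  - by case; left.
  - by rewrite bE e_irr in p4b.
have av : step e a v by right; rewrite e_sym.
have [r2 sr2 S3] := safe_step S2 av (or_introl erefl).
have br2 : e b r2.
  by case: sr2 => // bE; rewrite bE (safe_K S3) in bK.
exists b; split=> //.
have C' : cycle5 p1 p2 p3 p4 p0 by do 4!apply: cycle5_rotr.
have [r2E|r2E] := cycle5_opp C' S3; subst r2; rewrite e_sym // in br2 *.
have [bE|bE|bE] := cycle5_nbr deg3 C aK p0a br2.
- by rewrite bE KE !inE eqxx orbT in bK.
- by rewrite bE p4K in bK.
- by case: (safe_farl S2); left.
Qed.

(** Three successive chases yield [b], [c], [d]. Since [p4] has just one outside neighbour, [d = b],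
    which is then adjacent to [v], [p1], [p2] and [p4]. *)
Lemma chase5_captured p0 p1 p2 p3 p4 a : (forall x, #|nbhd x| <= 3) ->
  chase5 p0 p1 p2 p3 p4 -> a \notin K -> ~ e p0 a.
Proof.
move=> deg3 Ch0 aK p0a; have [[u KE _ _] _] := Ch0.
have Ch4 := chase5_rotr Ch0; have Ch3 := chase5_rotr Ch4.
have [b [bK p4b p1b]] := chase5_step deg3 Ch0 aK p0a.
have [c [cK p3c _]] := chase5_step deg3 Ch4 bK p4b.
have [d [dK p2d p4d]] := chase5_step deg3 Ch3 cK p3c.
have p4K : p4 \in K by rewrite KE !inE eqxx !orbT.
have db : d = b.
  have [dE|dE|//] := cycle5_nbr deg3 Ch4.1 bK p4b p4d.
    by rewrite dE KE !inE eqxx in dK.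
  by rewrite dE KE !inE eqxx !orbT in dK.
subst d; have vb := K_out p4K bK p4b.
have vp y : y \in [:: p0; p1; p2; p3; p4] -> v != y.
  by rewrite -KE => yK; apply/eqP => vy; apply: (K_far yK); left.
apply: (@nbhd_ltn_size b [:: v; p1; p2; p4] 3 (deg3 b)) => //.
  rewrite /= !inE !negb_or !vp ?inE ?eqxx ?orbT //=.
  move: u; rewrite /= !inE !negb_or => /and5P [_ /and3P [-> _ ->]].
  by case/andP => _ ->.
by rewrite /= !(e_sym b) vb p1b p2d p4b.
Qed.

(** Up to reversal a chase exists, and its rotations reach every cycle vertex, so no edge leaves
    [K], against connectedness. *)
Lemma no_cycle5 p0 p1 p2 p3 p4 :
  (forall x, #|nbhd x| <= 3) -> ~ cycle5 p0 p1 p2 p3 p4.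
Proof.
move=> deg3 C.
wlog Ch : p0 p1 p2 p3 p4 C / chase5 p0 p1 p2 p3 p4.
  move=> IH; have [r rK S] := K_robber p2.
  have [rE|rE] := cycle5_opp C S; subst r.
    exact: (IH p0 p1 p2 p3 p4).
  by have C' := cycle5_rev C; apply: (IH p4 p3 p2 p1 p0).
have Ch4 := chase5_rotr Ch; have Ch3 := chase5_rotr Ch4.
have Ch2 := chase5_rotr Ch3; have Ch1 := chase5_rotr Ch2.
have [_ KE _ _] := C.
have p0K : p0 \in K by rewrite KE !inE eqxx.
have vK : v \in K.
  apply: (nbr_closed_setT p0K) => y z yK yz.
  apply: contrapT => /negP zK; move: yK yz; rewrite KE !inE.
  by case/or4P => [/eqP->|/eqP->|/eqP->|/orP [] /eqP->];
     [apply: chase5_captured Ch _|apply: chase5_captured Ch1 _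
     |apply: chase5_captured Ch2 _|apply: chase5_captured Ch3 _
     |apply: chase5_captured Ch4 _].
by apply: (K_far vK); left.
Qed.

End Full.

(** * Counting vertices and degrees *)

Lemma K_full_card : #|T| <= (#|K| + #|nbhd v|).+1 ->
  forall x, x \notin K -> step e v x.
Proof.
move=> leT x xK; apply: contrapT => nvx.
have := @card_far_nbhd v (x |: K); rewrite cardsU1 xK addSn ltnNge leT => H.
suff : false by []; apply: H => y; rewrite !inE => /orP [/eqP -> //|].
exact: K_far.
Qed.

(** At least two neighbours of [r] lie in [nbhd u] by [Knbhd_gt1], and at least two outside it by
    [pinned_nbhd]. *)
Lemma pinned_degree u r d : (forall x, #|nbhd x| <= d) ->
  u \in K -> r \in K -> safe v u r -> Knbhd r \subset nbhd u -> 3 < d.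
Proof.
move=> degd uK rK S cov; apply: leq_trans (degd r).
have gt1 := Knbhd_gt1 uK rK S cov; have gt1' := pinned_nbhd rK S cov.
rewrite -(cardsID (nbhd u)); apply: (@leq_add 2 2 _ _ _ gt1').
apply: leq_trans gt1 _; apply/subset_leq_card/subsetP => x xN.
by have := subsetP cov _ xN; move: xN; rewrite !inE => /andP [-> _].
Qed.

Lemma confined_captured : #|T| <= 9 -> ~ (forall x, #|nbhd x| <= #|nbhd v|).
Proof.
move=> leT9 maxv; have cKv := card_far_nbhd K_far.
have [r0 r0K _] := K_robber v.
have far u r : safe v u r -> (r != u) && (r \notin nbhd u).
  move=> S; rewrite inE; apply/andP; split.
    by apply/eqP => ru; apply: (safe_farr S); left.
  by apply/negP => ur; apply: (safe_farr S); right.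
have [deg2v|deg3v] := leqP #|nbhd v| 2.
  have degK x : #|Knbhd x| <= 2.
    apply: leq_trans deg2v; apply: leq_trans (maxv x).
    by apply/subset_leq_card/subsetIl.
  (* A vertex of [K] with a neighbour outside would have at most one inside, so no edge leaves
     [K]. *)
  have vK : v \in K.
    apply: (nbr_closed_setT r0K) => y z yK yz; apply: contrapT => /negP zK.
    apply: (path_like_captured (fun x _ => degK x) yK).
    rewrite -ltnS; apply: leq_trans (leq_trans (maxv y) deg2v).
    apply: proper_card; rewrite properE subsetIl /=; apply/subsetPn; exists z.
      by rewrite inE.
    by rewrite !inE (negbTE zK) andbF.
  by apply: (K_far vK); left.
have [|noBig] := pselect (exists2 u, u \in K & 2 < #|Knbhd u|).
  case=> u uK gt2; have [r rK S] := K_robber u; have /andP [ru rNu] := far _ _ S.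
  have subK : [set u; r] :|: Knbhd u \subset K.
    by rewrite !subUset !sub1set uK rK subsetIr.
  have cU : #|[set u; r] :|: Knbhd u| = #|Knbhd u| + 2.
    rewrite cardsU cards2 eq_sym ru addnC.
    suff -> : [set u; r] :&: Knbhd u = set0 by rewrite cards0 subn0.
    apply/setP => x; rewrite !inE; apply/negbTE/negP.
    case/andP=> /orP [] /eqP -> /andP []; first by rewrite e_irr.
    by move: rNu; rewrite inE => /negbTE ->.
  have := subset_leq_card subK; rewrite cU => leK.
  (* Here [#|K| <= 8 - 3], so these five or more vertices exhaust [K] and [v] has degree 3; the
     second cop on [u] then covers [Knbhd r]. *)
  have KE : [set u; r] :|: Knbhd u = K.
    by apply/eqP; rewrite eqEcard subK cU; lia.
  suff : 3 < 3 by [].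
  apply: (@pinned_degree u r 3) => // [x|]; first by have := maxv x; lia.
  apply/subsetP => x xN; have : x \in K by move: xN; rewrite inE => /andP [].
  rewrite -KE !inE => /orP [/orP [] /eqP xE|/andP [] //]; subst x.
    by move: xN rNu; rewrite !inE e_sym => /andP [->].
  by move: xN; rewrite !inE e_irr.
have deg2 x : x \in K -> #|Knbhd x| = 2.
  move=> xK; apply/eqP; rewrite eqn_leq; apply/andP.
  have le2 y : y \in K -> #|Knbhd y| <= 2.
    by move=> yK; rewrite leqNgt; apply/negP => gt2; apply: noBig; exists y.
  split; first exact: le2.
  by rewrite ltnNge; apply/negP; apply: path_like_captured.
have [u uK _] := K_robber v.
have [q qK S] := K_robber u; have /andP [qu qN] := far _ _ S.
have /eqP/cards2P [x [z [xz NuE]]] := deg2 u uK.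
have [xN zN] : x \in Knbhd u /\ z \in Knbhd u by rewrite NuE !inE !eqxx orbT.
move: xN zN; rewrite !inE => /andP [ux xK] /andP [uz zK].
rewrite inE in qN.
have uniq4 : uniq [:: u; x; q; z].
  rewrite /= !inE !negb_or xz (eq_sym u q) qu andbT.
  have ne y w : e u y -> ~~ e u w -> y != w.
    by move=> uy; apply: contraNneq => <-.
  rewrite (ne x q) // (eq_sym q) (ne z q) // (eq_sym u) (ne x u) ?e_irr //.
  by rewrite (eq_sym u) (ne z u) ?e_irr.
have sub4 : {subset [:: u; x; q; z] <= K}.
  by move=> y; rewrite !inE => /or4P [] /eqP ->.
have ge4 : 4 <= #|K|.
  by rewrite -[4](card_uniqP uniq4); apply/subset_leq_card/subsetP.
have [le4|gt4] := leqP #|K| 4.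
  have KE := eq_mem_card uniq4 sub4 le4.
  have cnt y : y \in K -> count (e y) [:: u; x; q; z] = 2.
    by move=> yK; rewrite -(Knbhd_count _ uniq4 KE) deg2.
  have := cnt x xK; have := cnt q qK; have := cnt z zK; rewrite /= !e_irr.
  rewrite (e_sym z q) (e_sym z x) (e_sym q x) (e_sym z u) (e_sym x u).
  rewrite (e_sym q u) ux uz (negbTE qN).
  (* As [K] is 2-regular, only the cycle [u x q z] survives. *)
  case xqE: (e x q); case xzE : (e x z); case qzE : (e q z) => // _ _ _.
  have C : cycle4 u x q z.
    by split=> //; rewrite ?ux ?xqE ?qzE ?qN ?xzE // e_sym.
  have [eqH|neH] := leqP #|T| (#|K| + #|nbhd v|).+1.
    apply: (no_cycle4 (K_full_card eqH) _ C) => y.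
    by apply: leq_trans (maxv y) _; move: cKv leT9 ge4; clear; lia.
  (* A further vertex outside [K] and the closed neighbourhood of [v] lowers the maximum degree to
     3, while [u] covers [Knbhd q]. *)
  suff : 3 < 3 by [].
  apply: (@pinned_degree u q 3) => // [y|].
    by apply: leq_trans (maxv y) _; move: neH leT9 ge4; clear; lia.
  apply/subsetP => y; rewrite !inE KE !inE => /andP [qy].
  case/or4P => /eqP yE; subst y; rewrite ?e_irr // in qy *.
  by rewrite e_sym qy in qN.
have [p] : exists2 p, p \in K & p \notin [:: u; x; q; z].
  apply/subsetPn; apply: contraL gt4 => /subset_leq_card; rewrite -leqNgt.
  by rewrite (card_uniqP uniq4).
move=> pK pN; have uniq5 : uniq [:: p; u; x; q; z] by rewrite cons_uniq pN.
have sub5 : {subset [:: p; u; x; q; z] <= K}.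
  by move=> y; rewrite inE => /orP [/eqP -> //|]; apply: sub4.
have KE : K =i [:: p; u; x; q; z].
  by apply: eq_mem_card => //=; move: cKv leT9 deg3v; clear; lia.
have full : forall y, y \notin K -> step e v y 
  by apply: K_full_card; move: leT9 gt4 deg3v; clear; lia.
have deg3 y : #|nbhd y| <= 3 
  by apply: leq_trans (maxv y) _; move: cKv leT9 gt4; clear; lia.
have upN : ~~ e u p.
  have : p \notin Knbhd u.
    by rewrite NuE; apply: contra pN; rewrite !inE => /orP [] ->; rewrite ?orbT.
  by rewrite !inE pK andbT.
have cnt y : y \in K -> count (e y) [:: p; u; x; q; z] = 2.
  by move=> yK; rewrite -(Knbhd_count _ uniq5 KE) deg2.
have := cnt x xK; have := cnt q qK; have := cnt z zK; have := cnt p pK.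
rewrite /= !e_irr (e_sym z q) (e_sym z x) (e_sym q x) (e_sym z u) (e_sym x u).
rewrite (e_sym q u) (e_sym p u) (e_sym p x) (e_sym p q) (e_sym p z).
rewrite ux uz (negbTE qN) (negbTE upN).
(* 2-regularity leaves two cycles, in which [q] follows [x] or [z]. *)
case xqE: (e x q); case xzE : (e x z); case qzE : (e q z);
  case xpE : (e x p); case qpE : (e q p); case zpE : (e z p) => // _ _ _ _.
- have : cycle5 u x q p z.
    split.
    - by rewrite -(perm_uniq (s1 := [:: p; u; x; q; z])) //;
         apply/permP => f /=; clear; lia.
    - by move=> y; rewrite KE !inE; do 5![case: eqP => _ //=].
    - by rewrite ux xqE qpE (e_sym p) zpE e_sym.
    - by rewrite qN xpE qzE e_sym upN e_sym xzE.
  exact: no_cycle5.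
- have : cycle5 u x p q z.
    split.
    - by rewrite -(perm_uniq (s1 := [:: p; u; x; q; z])) //;
         apply/permP => f /=; clear; lia.
    - by move=> y; rewrite KE !inE; do 5![case: eqP => _ //=].
    - by rewrite ux xpE (e_sym p) qpE qzE e_sym.
    - by rewrite upN xqE e_sym zpE e_sym qN e_sym xzE.
  exact: no_cycle5.
Qed.

End Confined.

(** * The choice of the guarded vertex and the component *)

Lemma two_cops_win : 0 < #|T| -> #|T| <= 9 -> cops_win e 2.
Proof.
move=> /card_gt0P [x0 _] leT9; apply: contrapT => noW.
have S0 a b : exists r, safe a b r.
  apply: contrapT => noS; apply: noW; apply: (@wins_in_cops_win a b) => r.
  apply: contrapT => noN; apply: noS; exists r => n Wn.
  by apply: noN; exists n.
have [v _ maxv] := @arg_maxnP T x0 xpredT (fun x => #|nbhd x|) isT.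
have [r0 Sr0] := S0 v v.
pose far : {set T} := [set x | (x != v) && ~~ e v x].
have farP x : reflect (~ step e v x) (x \in far).
  rewrite inE -negb_or; apply: (iffP negP) => H H'; apply: H.
    by case: H' => ->; rewrite ?eqxx ?orbT.
  by case/orP: H' => [/eqP ->|]; [left|right].
(* [K] is the component, among the non-neighbours of [v], of a robber safe from two cops on [v]. *)
pose eF := [rel x y | [&& x \in far, y \in far & e x y]].
pose K := [set x | connect eF r0 x].
have r0far : r0 \in far by apply/farP; apply: safe_farl Sr0.
have Kfar x : x \in K -> x \in far.
  rewrite inE => /connectP [p]; elim: p r0 r0far {K Sr0} => [|z p IH] y yF /=.
    by move=> _ ->.
  by case/andP => /and3P [_ zF _]; apply: IH.
have Kcl x y : x \in K -> e x y -> y \notin K -> e v y.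
  move=> xK xy; apply: contraNT => vy; move: (xK); rewrite !inE => r0x.
  apply: connect_trans r0x (connect1 _); rewrite /= Kfar // xy andbT.
  rewrite inE vy andbT; apply: contraTneq xy => ->.
  by rewrite e_sym; have := Kfar _ xK; rewrite inE => /andP [].
apply: (@confined_captured v K _ Kcl _ _ leT9) => //.
- by move=> x /Kfar/farP.
- move=> X x XK xX Xcl.
  have eF_sym : connect_sym eF.
    by apply: sym_connect_sym => y z; rewrite /= andbCA e_sym.
  apply/subsetP => y; rewrite inE => r0y.
  have : connect eF x y.
    apply: connect_trans r0y; rewrite eF_sym.
    by have := subsetP XK _ xX; rewrite inE.
  case/connectP => p; elim: p x xX => [|z p IH] w wX /=; first by move=> _ ->.
  case/andP => wz zp; apply: IH zp; case/and3P: (wz) => _ _ ewz.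
  apply: (Xcl _ _ wX _ ewz); have := subsetP XK _ wX; rewrite !inE => r0w.
  by apply: connect_trans r0w (connect1 _).
(* The second cop walks from [v] to [u] while the first stays, and the robber survives inside
   [K]. *)
- move=> u; have /connectP [p vp ->] := e_conn v u.
  suff walk b r : r \in K -> safe v b r -> path e b p ->
      exists2 r', r' \in K & safe v (last b p) r'.
    by apply: walk Sr0 vp; rewrite inE.
  elim: p b r {vp} => [|z p IH] b r rK S /=; first by exists r.
  case/andP => bz; have [r' [r'K _ S']] := safe_stepK Kcl rK S (or_intror bz).
  exact: IH r'K S'.
- by move=> x; apply: maxv.
Qed.

End TwoCops.

Theorem theorem1 (T : finType) (e : rel T)
  (e_sym : symmetric e) (e_irr : irreflexive e)
  (e_conn : graph_connected e) (leT9 : #|T| <= 9) :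
  cop_number e <= 2.
Proof.
case: e_conn => T0 conn; rewrite /cop_number; case: ex_minnP => m _; apply.
by apply/asboolP; apply: two_cops_win.
Qed.
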